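(* Let $1\le k\le n$, let $l_1,\dots,l_k\in\mathbb{R}[Z_1,\dots,Z_n]$ be linearly independent linear forms, let $L:\mathbb{R}^n\to\mathbb{R}^k$, $z\mapsto(l_1(z),\dots,l_k(z))$, and let $a\in\mathbb{R}^k$. If $Z_1,Z_2\in\operatorname{span}(l_1,\dots,l_k)$, then $\mathcal{H}_L(a)$ is compact.
   Context: For $z\in\mathbb{R}^n$ let $f_z:=T^n-z_1T^{n-1}+\dots+(-1)^nz_n\in\mathbb{R}[T]$, let $\mathcal{H}:=\{z\in\mathbb{R}^n : f_z \text{ has only real roots}\}$, and let $\mathcal{H}_L(a):=\mathcal{H}\cap L^{-1}(a)$. (The hypothesis involving $Z_2$ presupposes $n\ge2$.) *)

(* Defs.v *)
From HB Require Import structures.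
From mathcomp Require Import all_boot all_order all_algebra.
From mathcomp Require Import all_classical all_reals all_analysis.
From mathcomp Require Import complex.
(* The notations of mpoly clash with those of mathcomp-analysis. *)
From mathcomp Require Import -(notations) mpoly.

Set Implicit Arguments.
Unset Strict Implicit.
Unset Printing Implicit Defensive.

Import Order.TTheory GRing.Theory Num.Theory.
Import numFieldNormedType.Exports.

Local Open Scope classical_set_scope.
Local Open Scope ring_scope.

(* Coordinates are numbered from 0: [z 0 i] is the mathematical z_(i+1), and
   [Zvar R i] below is the indeterminate Z_(i+1). *)
Definition fpoly (R : realType) (n : nat) (z : 'rV[R]_n) : {poly R} :=
  'X^n + \sum_(i < n) ((-1) ^+ i.+1 * z 0 i) *: 'X^(n - i.+1).

Definition only_real_roots (R : realType) (p : {poly R}) : Prop :=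
  forall x : R[i], root (map_poly (real_complex R) p) x -> complex.Im x = 0.

Definition hyperbolic (R : realType) (n : nat) : set 'rV[R]_n :=
  [set z | only_real_roots (fpoly z)].

(* [dhomog n R 1] is the type of homogeneous polynomials of degree 1 in n
   indeterminates, 0 included, i.e. of linear forms. *)
Lemma Zvar_homog (R : realType) (n : nat) (i : 'I_n) :
  @mpolyX n R (mnm1 i) \is @ishomog1 n R 1 mdeg.
Proof. by rewrite dhomogX; apply/eqP; exact: mdeg1. Qed.

Definition Zvar (R : realType) (n : nat) (i : 'I_n) : dhomog n R 1 :=
  DHomog (Zvar_homog R i).

Definition Lmap (R : realType) (n k : nat) (l : k.-tuple (dhomog n R 1))
    (z : 'rV[R]_n) : 'rV[R]_k :=
  \row_(j < k) meval (fun i => z 0 i) (tnth l j).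

Definition hyperbolic_fiber (R : realType) (n k : nat)
    (l : k.-tuple (dhomog n R 1)) (a : 'rV[R]_k) : set 'rV[R]_n :=
  @hyperbolic R n `&` Lmap l @^-1` [set a].

(* Main.v *)
(* The hyperbolic set is the image of R^n under the continuous map [vieta]
   sending a point x to the signed coefficients of \prod_j (T - x_j).  Since
   sum_j x_j^2 = e_1^2 - 2 e_2 and z_1 = e_1, z_2 = e_2 are constant on the
   fibre of L, the preimage of the fibre under [vieta] is closed and bounded.
   The hyperbolic fibre is thus a continuous image of a compact set; no
   continuity of roots is needed. *)
Require Import Defs.
From HB Require Import structures.
From mathcomp Require Import all_boot all_order all_algebra.
From mathcomp Require Import all_classical all_reals all_analysis.
From mathcomp Require Import complex.
From mathcomp Require Import -(notations) mpoly.
From mathcomp Require Import ring lra.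

Set Implicit Arguments.
Unset Strict Implicit.
Unset Printing Implicit Defensive.

Import Order.TTheory GRing.Theory Num.Theory.
Import numFieldNormedType.Exports.
Local Open Scope classical_set_scope.
Local Open Scope ring_scope.

(** A neighbourhood of a row contains a box of neighbourhoods of its finitely many entries. *)
Lemma continuous_row (T U : topologicalType) (n : nat) (f : T -> 'rV[U]_n) :
  (forall i, continuous (fun x => f x 0 i)) -> continuous f.
Proof.
move=> fc x B [P nP sPB].
have Pf : \forall y \near x, forall i, P 0 i (f y 0 i).
  by apply: filter_forall => i; apply: fc; exact: nP.
by apply: filterS Pf => y Py; apply: sPB => i j; rewrite ord1.
Qed.

Lemma size_fpoly (R : realType) (n : nat) (z : 'rV[R]_n) :
  size (fpoly z) = n.+1.
Proof.
rewrite /fpoly size_polyDl size_polyXn // ltnS.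
apply: leq_trans (size_sum _ _ _) _; apply/bigmax_leqP => i _.
by rewrite (leq_trans (size_scale_leq _ _)) // size_polyXn subnSK // leq_subr.
Qed.

Lemma coef_fpoly (R : realType) (n : nat) (z : 'rV[R]_n) (i : 'I_n) :
  (fpoly z)`_(n - i.+1) = (-1) ^+ i.+1 * z 0 i.
Proof.
(* [n - j.+1] is the value of [rev_ord j], so distinct indices give distinct degrees. *)
have subnS_eq (j k : 'I_n) : (n - j.+1 == n - k.+1)%N = (j == k).
  by apply/eqP/eqP => [jk|->//]; apply/rev_ord_inj/val_inj.
rewrite /fpoly coefD coefXn coef_sum (bigD1 i) //= big1 => [|j ji].
  rewrite coefZ coefXn eqxx mulr1 addr0 ltn_eqF ?add0r //.
  by rewrite subnSK // leq_subr.
by rewrite coefZ coefXn subnS_eq eq_sym (negPf ji) mulr0.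
Qed.

Lemma monic_fpoly (R : realType) (n : nat) (z : 'rV[R]_n) : fpoly z \is monic.
Proof.
rewrite monicE lead_coefE size_fpoly /= /fpoly coefD coefXn eqxx coef_sum.
rewrite big1 ?addr0 // => i _; rewrite coefZ coefXn gtn_eqF ?mulr0 //.
by rewrite subnSK // leq_subr.
Qed.

(** Entry [i] is the elementary symmetric polynomial e_(i+1) of the entries of [x], read off as a
    coefficient. *)
Definition vieta (R : realType) (n : nat) (x : 'rV[R]_n) : 'rV[R]_n :=
  \row_i ((-1) ^+ i.+1 * (\prod_(j < n) ('X - (x 0 j)%:P))`_(n - i.+1)).

Lemma fpoly_vieta (R : realType) (n : nat) (x : 'rV[R]_n) :
  fpoly (vieta x) = \prod_(j < n) ('X - (x 0 j)%:P).
Proof.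
set p := \prod_(j < n) _.
have sp : size p = n.+1.
  by rewrite size_prod_XsubC /index_enum -enumT size_enum_ord.
have pn : p`_n = 1.
  have : p \is monic by exact: monic_prod_XsubC.
  by rewrite monicE lead_coefE sp => /eqP.
rewrite -[RHS]coefK sp poly_def big_ord_recr /= pn scale1r addrC /fpoly.
(* [fpoly] lists degrees downwards, hence the reversal; the signs of [fpoly] and [vieta] then
   cancel. *)
congr (_ + _); rewrite [RHS](reindex_inj rev_ord_inj) /=.
by apply: eq_bigr => i _; rewrite mxE mulrA -exprD addnn -signr_odd odd_double mul1r.
Qed.

Lemma fpoly_inj (R : realType) (n : nat) : injective (@fpoly R n).
Proof.
move=> z w zw; apply/rowP => i; apply: (@mulfI _ ((-1) ^+ i.+1)).
  by rewrite signr_eq0.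
by rewrite -!coef_fpoly zw.
Qed.

Lemma only_real_roots_prod (R : realType) (s : seq R) :
  only_real_roots (\prod_(x <- s) ('X - x%:P)).
Proof.
move=> c; rewrite -(prod_map_poly _ _ predT) root_prod_XsubC.
by case/mapP => y _ ->.
Qed.

(** The polynomial splits over [R[i]]. Each root equals the embedding of its real part, and the
    embedding of polynomials is injective, so the factorization descends to [R]. *)
Lemma only_real_roots_split (R : realType) (p : {poly R}) :
  p \is monic -> only_real_roots p ->
  exists s : seq R, p = \prod_(x <- s) ('X - x%:P).
Proof.
move=> p_monic p_real.
have [rs rsE] := closed_field_poly_normal (map_poly (real_complex R) p).
move: rsE; rewrite lead_coef_map (eqP p_monic) rmorph1 scale1r => rsE.
exists (map (@complex.Re R) rs).
apply: (map_poly_inj (real_complex R)).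
rewrite -(prod_map_poly _ _ predT) -map_comp map_id_in //= => c crs.
have /p_real : root (map_poly (real_complex R) p) c.
  by rewrite rsE root_prod_XsubC.
by case: c {crs} => a b /= ->.
Qed.

Lemma hyperbolicE (R : realType) (n : nat) :
  @hyperbolic R n = range (@vieta R n).
Proof.
apply/seteqP; split => [z /(only_real_roots_split (monic_fpoly z)) [s sE]|].
  (* Comparing degrees shows that there are exactly [n] roots with multiplicity. *)
  have ss : size s == n.
    by rewrite -eqSS -(size_prod_XsubC s id) -sE size_fpoly.
  exists (\row_i tnth (Tuple ss) i) => //; apply: fpoly_inj.
  rewrite fpoly_vieta sE -[s in RHS]/(tval (Tuple ss)) big_tuple.
  by apply: eq_bigr => i _; rewrite mxE.
move=> _ [x _ <-]; rewrite /hyperbolic /= fpoly_vieta.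
have := @only_real_roots_prod R (map (x 0) (enum 'I_n)).
by rewrite big_map big_enum.
Qed.

(** By induction on the factors: a new factor turns the coefficient of index m into p_(m-1) - g p_m,
    so the induction has to cover all [m] at once. *)
Lemma continuous_coef_prod_XsubC (R : realType) (T : topologicalType)
    (I : Type) (g : I -> T -> R) (s : seq I) (m : nat) :
  (forall i, continuous (g i)) ->
  continuous (fun x => (\prod_(i <- s) ('X - (g i x)%:P))`_m).
Proof.
move=> gc; elim: s m => [|i s IHs] m.
  have -> : (fun x => (\prod_(i <- [::]) ('X - (g i x)%:P))`_m) =
      cst (1 : {poly R})`_m.
    by apply/funext => x; rewrite big_nil.
  exact: cst_continuous.
have -> : (fun x => (\prod_(j <- i :: s) ('X - (g j x)%:P))`_m) =
    (fun x => (if m == 0%N then 0 else (\prod_(j <- s) ('X - (g j x)%:P))`_m.-1)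
              - g i x * (\prod_(j <- s) ('X - (g j x)%:P))`_m).
  by apply/funext => x; rewrite big_cons mulrBl coefB coefXM coefCM.
move=> x; apply: cvgB; last by apply: cvgM; [exact: gc|exact: IHs].
by case: m => [|m]; [exact: cst_continuous|exact: IHs].
Qed.

Lemma continuous_vieta (R : realType) (n : nat) : continuous (@vieta R n).
Proof.
have scale (T : topologicalType) (c : R) (f : T -> R) :
    continuous f -> continuous (fun x => c * f x).
  by move=> fc x; apply: cvgM; [exact: cst_continuous|exact: fc].
apply: continuous_row => i.
have -> : (fun x : 'rV[R]_n => vieta x 0 i) = (fun x => (-1) ^+ i.+1 *
    (\prod_(j < n) ('X - (x 0 j)%:P))`_(n - i.+1)).
  by apply/funext => x; rewrite mxE.
apply: scale.
apply: (continuous_coef_prod_XsubC (g := fun j (x : 'rV[R]_n) => x 0 j)) => j.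
exact: coord_continuous.
Qed.

Lemma continuous_meval (R : realType) (T : topologicalType) (n : nat)
    (g : 'I_n -> T -> R) (p : mpoly n R) :
  (forall i, continuous (g i)) -> continuous (fun x => meval (g^~ x) p).
Proof.
move=> gc; have -> : (fun x => meval (g^~ x) p) = (fun x =>
    \sum_(m <- msupp p) mcoeff m p * \prod_i g i x ^+ m i).
  by apply/funext => x; rewrite mevalE.
apply: continuous_big => [|m _ x]; first exact: add_continuous.
apply: cvgM; first exact: cst_continuous.
apply: cvg_big => [|i _]; first exact: mul_continuous.
apply: (@cvg_comp _ _ _ (g i) (fun y => y ^+ m i)); first exact: gc.
exact: exprn_continuous.
Qed.

Lemma continuous_Lmap (R : realType) (n k : nat)
    (l : k.-tuple (dhomog n R 1)) : continuous (Lmap l).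
Proof.
apply: continuous_row => i.
have -> : (fun z : 'rV[R]_n => Lmap l z 0 i) =
    (fun z => meval (fun j => z 0 j) (tnth l i)).
  by apply/funext => z; rewrite mxE.
apply: (continuous_meval (g := fun j (z : 'rV[R]_n) => z 0 j)) => j.
exact: coord_continuous.
Qed.

(* The factor 'X^2 keeps the indices of the three top coefficients free of
   truncated subtraction. *)
Lemma sum_sqr_prod_XsubC (R : comRingType) (s : seq R) :
  let p := 'X^2 * \prod_(x <- s) ('X - x%:P) in
  [/\ forall i, p`_((size s).+3 + i) = 0, p`_(size s).+2 = 1 &
  \sum_(x <- s) x ^+ 2 = p`_(size s).+1 ^+ 2 - p`_(size s) *+ 2].
Proof.
elim: s => [|x s] /=.
  rewrite !big_nil mulr1 !coefXn; split=> //; last by rewrite /= expr0n mul0rn subrr.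
  by move=> i; rewrite coefXn.
rewrite !big_cons; set p := \prod_(y <- s) _.
rewrite mulrCA; move: ('X^2 * p) => {}p [p0 p1 pS].
have coefE m : (('X - x%:P) * p)`_m.+1 = p`_m - x * p`_m.+1.
  by rewrite mulrBl coefB coefXM coefCM.
split=> [i||]; first by rewrite addSn coefE -addnS !p0 mulr0 subrr.
  by rewrite coefE p1 -[(size s).+3]addn0 p0; ring.
(* With b, c the two coefficients below the leading 1, (b - x)^2 - 2(c - x b) = b^2 - 2c + x^2: the
   cross terms cancel. *)
by rewrite !coefE p1 pS; ring.
Qed.

Lemma sum_sqr_vieta (R : realType) (n : nat) (x : 'rV[R]_n.+2) :
  \sum_i x 0 i ^+ 2 = (vieta x) 0 (@Ordinal n.+2 0 isT) ^+ 2 -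
    (vieta x) 0 (@Ordinal n.+2 1 isT) *+ 2.
Proof.
have [_ _] := sum_sqr_prod_XsubC (map (x 0) (enum 'I_n.+2)).
(* Removing ['X^2] lowers the indices n+3 and n+2 to n+1 and n, the degrees that entries 0 and 1 of
   [vieta] read. *)
rewrite big_map big_enum big_map big_enum size_map size_enum_ord !coefXnM /= => ->.
by rewrite !mxE /= !subSS !subn0; ring.
Qed.

(** Evaluation at [z] is linear in the form, so a form in the span is constant on each fibre of
    L. *)
Lemma meval_span (R : realType) (n k : nat) (l : k.-tuple (dhomog n.+1 R 1))
    (p : dhomog n.+1 R 1) (z : 'rV[R]_n.+1) : p \in << l >>%VS ->
  meval (fun i => z 0 i) p = \sum_(j < k) coord l j p * Lmap l z 0 j.
Proof.
move=> /coord_span {1}->; rewrite raddf_sum raddf_sum /=.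
by apply: eq_bigr => j _; rewrite mxE -mevalZ (tnth_nth 0).
Qed.

Theorem lemma2p23 (R : realType) (n k : nat) (hk : (1 <= k <= n.+2)%N)
    (l : k.-tuple (dhomog n.+2 R 1)) (hl : free l) (a : 'rV[R]_k)
    (hZ1 : Zvar R (@Ordinal n.+2 0 isT) \in << l >>%VS)
    (hZ2 : Zvar R (@Ordinal n.+2 1 isT) \in << l >>%VS) :
  compact (hyperbolic_fiber l a).
Proof.
(* The value of coordinate [i] on the fibre over [a], once Z_(i+1) lies in the span. *)
pose c i := \sum_(j < k) coord l j (Zvar R i) * a 0 j.
have coordE z i : Lmap l z = a -> Zvar R i \in << l >>%VS -> z 0 i = c i.
  by move=> za /(meval_span z); rewrite za [LHS]mevalXU.
pose r := c (@Ordinal n.+2 0 isT) ^+ 2 - c (@Ordinal n.+2 1 isT) *+ 2.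
pose K := @vieta R n.+2 @^-1` (Lmap l @^-1` [set a]).
have -> : hyperbolic_fiber l a = @vieta R n.+2 @` K.
  rewrite /hyperbolic_fiber hyperbolicE.
  apply/seteqP; split=> [_ [[x _ <-] xa]|_ [x xK <-]]; first by exists x.
  by split=> //; exists x.
apply: continuous_compact.
  by apply: continuous_subspaceT; exact: continuous_vieta.
(* On [K] the squares of the entries sum to [r], so 0 <= x_i^2 <= r <= (r + 1)^2; the bound r + 1
   avoids a square root. *)
pose I : set R := `[- (r + 1), r + 1]%classic.
apply: (@subclosed_compact _ _ [set x : 'rV[R]_n.+2 | forall i, I (x 0 i)]).
- apply: preimage_closed; first by move=> x _; exact: continuous_vieta.
  apply: preimage_closed; first by move=> z _; exact: continuous_Lmap.
  apply: accessible_closed_set1; apply: hausdorff_accessible.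
  exact: norm_hausdorff.
- by apply: (rV_compact (A := fun=> I)) => i; exact: segment_compact.
move=> x xK i /=.
have : x 0 i ^+ 2 <= r.
  have <- : \sum_j x 0 j ^+ 2 = r.
    by rewrite sum_sqr_vieta /r !(coordE (vieta x)).
  by rewrite (bigD1 i) //= lerDl sumr_ge0 // => j _; rewrite sqr_ge0.
by rewrite /I /= in_itv /=; nra.
Qed.
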